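(* There is an absolute constant $C>0$ such that for every $d\ge1$ and every step size $h>0$, the spectral gap $\lambda$ of MALA with standard Gaussian target distribution $\pi=\mathcal N(0,I_d)$ and step size $h$ satisfies $\lambda\le C\,h$.
   Context: MALA with target $\pi=\mathcal N(0,I_d)$ and step size $h>0$: the proposal kernel $Q(x,\cdot)$ is the Gaussian $\mathcal N((1-h)x,2hI_d)$ with density $Q(x,y)$ (i.e. the potential is $V(x)=\|x\|^2/2$); acceptance probability $A(x,y)=\min\bigl\{1,\frac{\pi(y)Q(y,x)}{\pi(x)Q(x,y)}\bigr\}$; the MALA kernel is $T(x,B)=\int_BQ(x,y)A(x,y)\,dy+\mathbf 1_B(x)\bigl(1-\int_{\mathbb R^d}Q(x,y)A(x,y)\,dy\bigr)$. The Dirichlet form is $\mathcal E(f,g)=\mathbb E_\pi[f\,(\mathrm{id}-T)g]$ for $f,g\in L^2(\pi)$, with $(Tg)(x)=\int g(y)\,T(x,dy)$, and the spectral gap is $\lambda=\inf\bigl\{\frac{\mathcal E(f,f)}{\mathrm{Var}_\pi f}:f\in L^2(\pi),\ \mathrm{Var}_\pi f>0\bigr\}$. *)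

(* Defs.v *)
(* Spectral gap of the Metropolis-adjusted Langevin algorithm (MALA) for the
   standard Gaussian target on R^d, in MathComp-Analysis. *)
From HB Require Import structures.
From mathcomp Require Import all_boot all_order all_algebra.
From mathcomp Require Import all_classical all_reals all_analysis.
From mathcomp Require Import measurable_realfun.

Set Implicit Arguments.
Unset Strict Implicit.
Unset Printing Implicit Defensive.
Import Order.TTheory GRing.Theory Num.Theory.
Import numFieldNormedType.Exports.

Local Open Scope classical_set_scope.
Local Open Scope ring_scope.

(* Points of R^d are d-tuples of reals, because tuples (unlike row vectors) carry
   the product sigma-algebra. *)
Notation rspace R d := (d.-tuple (measurableTypeR R)).

Section lebesgue_rspace.
Context (R : realType).
Local Open Scope ereal_scope.

Definition cons_rspace n (p : measurableTypeR R * rspace R n) : rspace R n.+1 :=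
  [the n.+1.-tuple _ of p.1 :: p.2].

Lemma measurable_cons_rspace n : measurable_fun [set: _] (@cons_rspace n).
Proof. by apply: measurable_cons. Qed.

Section step.
Variables (n : nat) (mu : {sigma_finite_measure set (rspace R n) -> \bar R}).

Definition lebesgue_step : set (rspace R n.+1) -> \bar R :=
  pushforward (@lebesgue_measure R \x mu) (@cons_rspace n).

Let mc := @measurable_cons_rspace n.

Let step0 : lebesgue_step set0 = 0.
Proof. by rewrite /lebesgue_step /pushforward preimage_set0 measure0. Qed.

Let step_ge0 A : 0 <= lebesgue_step A.
Proof. exact: measure_ge0. Qed.

Let step_sigma_additive : semi_sigma_additive lebesgue_step.
Proof. by apply: measure_semi_sigma_additive. Qed.

HB.instance Definition _ := isMeasure.Build _ _ _ lebesgue_step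
  step0 step_ge0 step_sigma_additive.

Let step_sigma_finite : sigma_finite setT lebesgue_step.
Proof.
have /sigma_finiteP[F [TF ndF Foo]] := sigma_finiteT (@lebesgue_measure R).
have /sigma_finiteP[G [TG ndG Goo]] := sigma_finiteT mu.
pose u (t : rspace R n.+1) : measurableTypeR R * rspace R n :=
  (thead t, [tuple of behead t]).
have uK p : u (cons_rspace p) = p.
  by case: p => x t; rewrite /u /cons_rspace /= theadE; congr pair; apply/val_inj.
have mu_ : measurable_fun setT u.
  apply: measurable_fun_pair; first exact: measurable_tnth.
  exact: measurable_behead.
exists (fun k => u @^-1` (F k `*` G k)).
  rewrite -preimage_bigcup (_ : \bigcup_k _ = setT) ?preimage_setT//.
  apply/seteqP; split=> // -[x t] _.
  have [i _ Fx] : (\bigcup_i F i) x by rewrite -TF.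
  have [j _ Gt] : (\bigcup_i G i) t by rewrite -TG.
  exists (maxn i j) => //; split => /=.
  - by move: x Fx; exact/subsetPset/ndF/leq_maxl.
  - by move: t Gt; exact/subsetPset/ndG/leq_maxr.
move=> k; have [mF Fk] := Foo k; have [mG Gk] := Goo k.
have mFG : measurable (F k `*` G k) by exact: measurableX.
split; first by rewrite -[X in measurable X]setTI; exact: mu_.
rewrite /lebesgue_step /pushforward -comp_preimage (_ : u \o _ = id); last exact/funext.
by rewrite preimage_id product_measure1E// lte_mul_pinfty// ge0_fin_numE.
Qed.

HB.instance Definition _ := Measure_isSigmaFinite.Build _ _ _ lebesgue_step
  step_sigma_finite.

End step.

(* The library has no Lebesgue measure on R^n: it is the n-fold product of the
   one-dimensional one, moved to tuples along (x, t) |-> x :: t. *)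
Fixpoint lebesgue_rspace n : {sigma_finite_measure set (rspace R n) -> \bar R} :=
  match n with
  | 0 => \d_([tuple] : rspace R 0)
  | n'.+1 => lebesgue_step (lebesgue_rspace n')
  end.

Lemma ge0_integral_lebesgue_rspaceS n (f : rspace R n.+1 -> \bar R) :
  measurable_fun [set: rspace R n.+1] f -> (forall x, 0 <= f x) ->
  \int[lebesgue_rspace n.+1]_x f x =
  \int[@lebesgue_measure R]_t \int[lebesgue_rspace n]_x f (cons_rspace (t, x)).
Proof.
move=> mf f0.
have mc := @measurable_cons_rspace n.
rewrite /= /lebesgue_step ge0_integral_pushforward//= fubini_tonelli1//.
exact: measurableT_comp.
Qed.

End lebesgue_rspace.

Section gaussian.
Context (R : realType).

(* Density of N(m, s^2 I_d): s is the standard deviation, not the variance; the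
   closed form is gaussian_pdfE. For s = 0 the junk value of [normal_pdf] is
   still a probability density, so the instances below need no hypothesis. *)
Definition gaussian_pdf d (m : rspace R d) (s : R) (x : rspace R d) : R :=
  \prod_(i < d) normal_pdf (tnth m i) s (tnth x i).

Lemma gaussian_pdfE d (m : rspace R d) (s : R) (x : rspace R d) : 0 < s ->
  gaussian_pdf m s x = (Num.sqrt (2 * pi * s ^+ 2) ^+ d)^-1 *
    expR (- (\sum_(i < d) (tnth x i - tnth m i) ^+ 2) / (2 * s ^+ 2)).
Proof.
move=> s0; rewrite /gaussian_pdf.
under eq_bigr do rewrite normal_pdfE ?gt_eqF//.
rewrite big_split/= prodr_const card_ord exprVn; congr (_^-1 * _).
  by rewrite mulrC -mulrA -mulr_natl.
rewrite -expR_sum; congr expR; rewrite -sumrN mulr_suml.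
by apply: eq_bigr => i _; rewrite [in RHS]mulr_natl.
Qed.

Lemma gaussian_pdf_ge0 d (m : rspace R d) s x : 0 <= gaussian_pdf m s x.
Proof. by apply: prodr_ge0 => i _; exact: normal_pdf_ge0. Qed.

Lemma measurable_prod_normal_pdf d (m : 'I_d -> R) s : measurable_fun setT
  (fun x : rspace R d => \prod_(i < d) normal_pdf (m i) s (tnth x i)).
Proof.
apply: measurable_prod => i _.
apply: (measurableT_comp (measurable_normal_pdf _ _)).
exact: measurable_tnth.
Qed.

Lemma measurable_gaussian_pdf d (m : rspace R d) s :
  measurable_fun setT (gaussian_pdf m s).
Proof. exact: measurable_prod_normal_pdf. Qed.

Lemma integral_gaussian_pdf d (m : rspace R d) s :
  (\int[@lebesgue_rspace R d]_x (gaussian_pdf m s x)%:E = 1)%E.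
Proof.
rewrite /gaussian_pdf; move: {m}(tnth m : 'I_d -> R) => m.
elim: d m => [|d IH] m.
  rewrite [X in integral X]/=.
  under eq_integral do rewrite big_ord0.
  by rewrite integral_cst//= diracT mul1e.
have g0 n (g : 'I_n -> R) x :
    0 <= (\prod_(i < n) normal_pdf (g i) s (tnth (x : rspace R n) i)).
  by apply: prodr_ge0 => i _; exact: normal_pdf_ge0.
rewrite ge0_integral_lebesgue_rspaceS; last 2 first.
- by apply/measurable_EFinP; apply: measurable_prod_normal_pdf.
- by move=> x; rewrite lee_fin.
rewrite -[RHS](@integral_normal_pdf R (m ord0) s).
apply: eq_integral => t _.
pose g (x : rspace R d) :=
  \prod_(i < d) normal_pdf (m (lift ord0 i)) s (tnth x i).
transitivity (\int[@lebesgue_rspace R d]_x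
    ((normal_pdf (m ord0) s t)%:E * (g x)%:E))%E.
  apply: eq_integral => x _; rewrite big_ord_recl EFinM.
  by under eq_bigr do rewrite tnthS.
rewrite ge0_integralZl//= ?IH ?mule1//.
- by apply/measurable_EFinP; apply: measurable_prod_normal_pdf.
- by move=> x _; rewrite lee_fin g0.
- by rewrite lee_fin normal_pdf_ge0.
Qed.

Definition gaussian d (m : rspace R d) (s : R) (B : set (rspace R d)) : \bar R :=
  (\int[@lebesgue_rspace R d]_(x in B) (gaussian_pdf m s x)%:E)%E.

Section gaussian_probability.
Variables (d : nat) (m : rspace R d) (s : R).

Let gaussian0 : gaussian m s set0 = 0%E.
Proof. by rewrite /gaussian integral_set0. Qed.

Let gaussian_ge0 A : (0 <= gaussian m s A)%E.
Proof. by apply: integral_ge0 => x _; rewrite lee_fin gaussian_pdf_ge0. Qed.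

Let gaussian_sigma_additive : semi_sigma_additive (gaussian m s).
Proof.
apply: semi_sigma_additive_nng_induced.
- by apply/measurable_EFinP; apply: measurable_gaussian_pdf.
- by move=> x; rewrite lee_fin gaussian_pdf_ge0.
Qed.

HB.instance Definition _ := isMeasure.Build _ _ _ (gaussian m s)
  gaussian0 gaussian_ge0 gaussian_sigma_additive.

Let gaussian_setT : gaussian m s setT = 1%E.
Proof. exact: integral_gaussian_pdf. Qed.

HB.instance Definition _ := @Measure_isProbability.Build _ _ R
  (gaussian m s) gaussian_setT.

End gaussian_probability.

End gaussian.

Section mala.
Context (R : realType) (d : nat) (h : R).
Implicit Types (x y : rspace R d) (B : set (rspace R d)) (f g : rspace R d -> R).

Local Notation mu := (lebesgue_rspace R d).

Definition origin : rspace R d := [tuple 0 | _ < d].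

Definition mala_target : probability (rspace R d) R := gaussian origin 1.

Definition mala_target_pdf x : R := gaussian_pdf origin 1 x.

(* Density at y of N((1 - h) x, 2 h I_d). *)
Definition mala_proposal_pdf x y : R :=
  gaussian_pdf [tuple (1 - h) * tnth x i | i < d] (Num.sqrt (2 * h)) y.

Definition mala_accept x y : R :=
  Num.min 1 ((mala_target_pdf y * mala_proposal_pdf y x) /
             (mala_target_pdf x * mala_proposal_pdf x y)).

Definition mala_kernel x B : \bar R :=
  (\int[mu]_(y in B) (mala_proposal_pdf x y * mala_accept x y)%:E +
   (\1_B x)%:E *
     (1 - \int[mu]_y (mala_proposal_pdf x y * mala_accept x y)%:E))%E.

Lemma mala_proposal_pdf_ge0 x y : 0 <= mala_proposal_pdf x y.
Proof. exact: gaussian_pdf_ge0. Qed.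

Lemma mala_accept_ge0 x y : 0 <= mala_accept x y.
Proof.
by rewrite le_min ler01 divr_ge0 // mulr_ge0 ?gaussian_pdf_ge0.
Qed.

Lemma mala_accept_le1 x y : mala_accept x y <= 1.
Proof. by rewrite ge_min lexx. Qed.

Lemma measurable_mala_proposal_pdfl y :
  measurable_fun setT (fun x => mala_proposal_pdf x y).
Proof.
apply: measurable_prod => i _.
under eq_fun do rewrite tnth_mktuple.
have mi : measurable_fun setT
    (fun x : rspace R d => (1 - h) * tnth x i : measurableTypeR R).
  by apply: measurable_funM => //; exact: measurable_tnth.
have [s0|s0] := eqVneq (Num.sqrt (2 * h)) 0.
  by under eq_fun do rewrite /normal_pdf s0 eqxx; exact: measurable_cst.
rewrite (_ : (fun _ => _) =
    normal_pdf (tnth y i) (Num.sqrt (2 * h)) \o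
      (fun x : rspace R d => (1 - h) * tnth x i)).
  exact: measurableT_comp (measurable_normal_pdf _ _) mi.
apply/funext => x /=; rewrite !normal_pdfE// /normal_fun.
by rewrite -[in LHS]sqrrN opprB.
Qed.

Lemma measurable_mala_accept x : measurable_fun setT (mala_accept x).
Proof.
apply: measurable_minr => //; apply: measurable_funM.
  apply: measurable_funM; first exact: measurable_gaussian_pdf.
  exact: measurable_mala_proposal_pdfl.
under eq_fun do rewrite -powR_inv1 ?mulr_ge0 ?gaussian_pdf_ge0//.
apply: (measurableT_comp (measurable_powR _)).
by apply: measurable_funM => //; exact: measurable_gaussian_pdf.
Qed.

Section mala_kernel_probability.
Let k x y : \bar R := (mala_proposal_pdf x y * mala_accept x y)%:E.

Let k_ge0 x y : (0 <= k x y)%E.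
Proof. by rewrite lee_fin mulr_ge0 ?mala_proposal_pdf_ge0 ?mala_accept_ge0. Qed.

Let measurable_k x : measurable_fun setT (k x).
Proof.
apply/measurable_EFinP; apply: measurable_funM.
  exact: measurable_gaussian_pdf.
exact: measurable_mala_accept.
Qed.

Let int_k_le1 x : (\int[mu]_y k x y <= 1)%E.
Proof.
rewrite -(integral_gaussian_pdf [tuple (1 - h) * tnth x i | i < d] (Num.sqrt (2 * h))).
apply: ge0_le_integral => //.
- by apply/measurable_EFinP; apply: measurable_gaussian_pdf.
- move=> y _; rewrite lee_fin ler_piMr ?mala_accept_le1//.
  exact: mala_proposal_pdf_ge0.
Qed.

Let int_k_fin x : (\int[mu]_y k x y)%E \is a fin_num.
Proof.
rewrite ge0_fin_numE ?integral_ge0//.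
by rewrite (le_lt_trans (int_k_le1 x))// ltry.
Qed.

Let rej_ge0 x : (0 <= 1 - \int[mu]_y k x y)%E.
Proof. by rewrite sube_ge0// int_k_fin. Qed.

Variable x : rspace R d.

Let kernel0 : mala_kernel x set0 = 0%E.
Proof. by rewrite /mala_kernel integral_set0 indic0 mul0e adde0. Qed.

Let kernel_ge0 B : (0 <= mala_kernel x B)%E.
Proof.
apply: adde_ge0; first by apply: integral_ge0 => y _; exact: k_ge0.
by apply: mule_ge0; [rewrite lee_fin|exact: rej_ge0].
Qed.

Let kernel_sigma_additive : semi_sigma_additive (mala_kernel x).
Proof.
have r0 : 0 <= fine (1 - \int[mu]_y k x y)%E by rewrite fine_ge0.
pose rej := mscale (NngNum r0) \d_x.
move=> F mF tF mUF.
have rejE A : rej A = ((\1_A x)%:E * (1 - \int[mu]_y k x y))%E.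
  rewrite [LHS]muleC /= fineK; last by rewrite fin_numB int_k_fin.
  by rewrite diracE indicE.
have TE A : mala_kernel x A = (\int[mu]_(y in A) k x y + rej A)%E.
  by rewrite rejE.
have cvk := semi_sigma_additive_nng_induced (measurable_k x) (k_ge0 x) mF tF mUF.
have cvr := @measure_semi_sigma_additive _ _ _ rej F mF tF mUF.
rewrite TE (_ : (fun n => _) = (fun n =>
    \sum_(0 <= i < n) \int[mu]_(y in F i) k x y +
    \sum_(0 <= i < n) rej (F i))%E); last first.
  by apply/funext => n; rewrite -big_split/=; apply: eq_bigr => i _.
apply: cvgeD; [|exact: cvk|exact: cvr].
by rewrite ge0_adde_def// inE ?integral_ge0.
Qed.

HB.instance Definition _ := isMeasure.Build _ _ _ (mala_kernel x)
  kernel0 kernel_ge0 kernel_sigma_additive.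

Let kernel_setT : mala_kernel x setT = 1%E.
Proof. by rewrite /mala_kernel indicT mul1e addeC subeK// int_k_fin. Qed.

HB.instance Definition _ := @Measure_isProbability.Build _ _ R
  (mala_kernel x) kernel_setT.

End mala_kernel_probability.

(* [Rintegral] returns a junk value where f is not integrable for the kernel; for
   f in L^2(pi) this only concerns a pi-null set of x. *)
Definition mala_op f x : R := \int[mala_kernel x]_y f y.

Definition mala_dirichlet f g : \bar R :=
  ('E_mala_target[(f \* (g \- mala_op g))%R])%E.

(* The quotients are taken in \bar R; for f in L^2(pi) of positive variance both
   terms are finite. *)
Definition mala_gap : \bar R :=
  ereal_inf [set (mala_dirichlet f f / 'V_mala_target[f])%E | f in
    [set f | f \in Lfun mala_target 2%:E /\ (0 < 'V_mala_target[f])%E]].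

End mala.

(* Main.v *)
From HB Require Import structures.
Require Import Defs.
From mathcomp Require Import all_boot all_order all_algebra.
From mathcomp Require Import all_classical all_reals all_analysis.
From mathcomp Require Import measurable_realfun.
From mathcomp Require Import ring lra.

Set Implicit Arguments.
Unset Strict Implicit.
Unset Printing Implicit Defensive.

Import Order.TTheory GRing.Theory Num.Theory.
Import numFieldNormedType.Exports.
Local Open Scope ring_scope.
Local Open Scope classical_set_scope.

(** The gap is an infimum, so one test function suffices: the first coordinate
    clipped to the unit interval, [f x = min(max(x_0, 0), 1)]. The clipping
    keeps every integral finite, and makes the bound usable for large steps.

    Numerator. Let [w(x, y) = pi(x) Q(x, y) A(x, y)] be the density of accepted
    moves. Rejected moves contribute nothing to [f - Tf] ([sub_mala_op]), and
    [w(x, y) = min(pi(x) Q(x, y), pi(y) Q(y, x))] is symmetric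
    ([mala_flow_sym]), so that the Dirichlet form is one half of the integral
    of [w(x, y) (f x - f y)^2] ([mala_dirichletE]). Since the acceptance
    probability is at most 1, [w(x, y)] may be replaced by [pi(x) Q(x, y)];
    what remains involves the first coordinates only
    ([integral_gaussian_head]), hence no dimension. As [f] is 1-Lipschitz in
    the first coordinate and [y_0] is normal with mean [(1 - h) x_0] and
    variance [2h], the squared increment has mean O(h + h^2 x_0^2). This gives
    O(h) for h <= 1. For h >= 1 the increment is at most 1 and a constant bound
    is enough.

    Denominator. The variance of [f] under the target is that of a fixed
    function of one standard normal variable. It is bounded below by a positive
    constant because [f] is 0 on an interval and 1 on another, and both have
    positive mass ([variance_clip_head_ge]). *)

(** * Measures with a density *)

Section density_measure.
Context d (T : measurableType d) (R : realType).
Local Open Scope ereal_scope.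

(** The measurability and sign of the density are arguments of the definition
    so that the measure structure can be inferred from its application. *)
Definition density_measure (mu : {measure set T -> \bar R}) (p : T -> R)
    (mp : measurable_fun [set: T] p) (p_ge0 : forall x, (0 <= p x)%R)
    (A : set T) :=
  \int[mu]_(x in A) (p x)%:E.

Context (mu : {measure set T -> \bar R}) (p : T -> R).
Context (mp : measurable_fun [set: T] p) (p_ge0 : forall x, (0 <= p x)%R).

Local Notation nu := (density_measure mu mp p_ge0).

Let nu0 : nu set0 = 0.
Proof. by rewrite /density_measure integral_set0. Qed.

Let nu_ge0 A : 0 <= nu A.
Proof. by apply: integral_ge0 => x _; rewrite lee_fin. Qed.

Let nu_sigma_additive : semi_sigma_additive nu.
Proof. by apply: semi_sigma_additive_nng_induced => //; exact/measurable_EFinP. Qed.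

HB.instance Definition _ := isMeasure.Build _ _ _ nu nu0 nu_ge0
  nu_sigma_additive.

Import HBNNSimple.

Let ge0_integral_density_nnsfun (h : {nnsfun T >-> R}) :
  \int[nu]_x (h x)%:E = \int[mu]_x ((h x)%:E * (p x)%:E).
Proof.
under [LHS]eq_integral do rewrite fimfunE -fsumEFin//.
rewrite [LHS]ge0_integral_fsum//; last 2 first.
  - by move=> r; exact/measurable_EFinP/measurableT_comp.
  - by move=> n x _; rewrite EFinM nnfun_muleindic_ge0.
under [RHS]eq_integral.
  move=> x _; rewrite fimfunE -fsumEFin// ge0_mule_fsuml; last first.
    by move=> r; rewrite EFinM nnfun_muleindic_ge0.
  over.
rewrite [RHS]ge0_integral_fsum//; last 2 first.
  - move=> r; apply: emeasurable_funM; last exact/measurable_EFinP.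
    exact/measurable_EFinP/measurableT_comp.
  - move=> n x _; apply: mule_ge0; last by rewrite lee_fin.
    by rewrite EFinM nnfun_muleindic_ge0.
apply: eq_fsbigr => r _.
rewrite integralZl_indic_nnsfun// integral_indic// setIT.
rewrite /= /density_measure integral_mkcond.
have mA : measurable (h @^-1` [set r]) by [].
case: (pselect (exists x, h x = r)) => [[x hx]|nr]; last first.
  have -> : h @^-1` [set r] = set0 by rewrite -subset0 => x hx; apply: nr; exists x.
  rewrite patch_set0 integral0 mule0; apply/esym; rewrite integral0_eq// => x _.
  by rewrite indic0 mulr0 mul0e.
have r0 : (0 <= r)%R by rewrite -hx.
rewrite -ge0_integralZl//; last 2 first.
  - apply/(measurable_restrict (EFin \o p)) => //.
    by apply: measurable_funTS; exact/measurable_EFinP.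
  - by move=> y _; apply: erestrict_ge0 => z _; rewrite lee_fin.
apply: eq_integral => y _; rewrite patchE indicE.
by case: ifPn => _; rewrite ?mulr1 ?mulr0 ?mul0e ?mule0.
Qed.

(** By definition for indicator functions, hence by linearity for simple
    functions, hence by monotone convergence. *)
Lemma ge0_integral_density_measure (f : T -> \bar R) :
  measurable_fun [set: T] f -> (forall x, 0 <= f x) ->
  \int[density_measure mu mp p_ge0]_x f x = \int[mu]_x (f x * (p x)%:E).
Proof.
move=> mf f0; pose f_ := nnsfun_approx measurableT mf.
have cvf x : EFin \o f_^~ x @ \oo --> f x by exact: cvg_nnsfun_approx.
have ndf x : nondecreasing_seq (fun n => f_ n x).
  by move=> a b ab; exact/lefP/nd_nnsfun_approx.
transitivity (limn (fun n => \int[nu]_x (f_ n x)%:E)).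
  rewrite -monotone_convergence//=.
  - by apply: eq_integral => x _; apply/esym/cvg_lim => //=; exact: cvf.
  - by move=> n; exact/measurable_EFinP.
  - by move=> n x _; rewrite lee_fin.
  - by move=> x _ a b ab; rewrite lee_fin; exact: ndf.
under eq_fun do rewrite ge0_integral_density_nnsfun.
rewrite -monotone_convergence//=.
- apply: eq_integral => x _; apply/cvg_lim => //.
  by apply: cvgeMr => //; exact: cvf.
- by move=> n; apply: emeasurable_funM; exact/measurable_EFinP.
- by move=> n x _; rewrite mule_ge0 ?lee_fin.
- by move=> x _ a b ab; rewrite lee_wpmul2r ?lee_fin//; exact: ndf.
Qed.

End density_measure.

(** * Gaussian integrals *)

Section gaussian_integrals.
Context (R : realType).
Local Open Scope ereal_scope.

Lemma ge0_integral_gaussian d (m : rspace R d) (s : R)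
    (f : rspace R d -> \bar R) :
  measurable_fun [set: rspace R d] f -> (forall x, 0 <= f x) ->
  \int[gaussian m s]_x f x =
  \int[lebesgue_rspace R d]_x (f x * (gaussian_pdf m s x)%:E).
Proof.
move=> mf f0.
rewrite -(ge0_integral_density_measure _ (measurable_gaussian_pdf m s)
  (gaussian_pdf_ge0 m s))//.
Qed.

Lemma integral_gaussian d (m : rspace R d) (s : R)
    (f : rspace R d -> \bar R) :
  measurable_fun [set: rspace R d] f ->
  \int[gaussian m s]_x f x =
  \int[lebesgue_rspace R d]_x (f x * (gaussian_pdf m s x)%:E).
Proof.
move=> mf.
rewrite integralE [RHS]integralE !ge0_integral_gaussian//; last 2 first.
- exact: measurable_funeneg.
- exact: measurable_funepos.
congr (_ - _); apply: eq_integral => x _; have p0 := gaussian_pdf_ge0 m s x.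
  by rewrite !funeposE maxe_pMl// mul0e.
by rewrite !funenegE maxe_pMl// mul0e mulNe.
Qed.

(** A Gaussian density is a product over the coordinates, so Tonelli integrates
    out all of them but the first. This is where the dimension disappears. *)
Lemma integral_gaussian_head n (m : rspace R n.+1) (s : R) (g : R -> R) :
  measurable_fun [set: R] g -> (forall t, (0 <= g t)%R) ->
  \int[lebesgue_rspace R n.+1]_x (g (tnth x ord0) * gaussian_pdf m s x)%:E =
  \int[@lebesgue_measure R]_t (g t * normal_pdf (tnth m ord0) s t)%:E.
Proof.
move=> mg g0.
pose m' : rspace R n := [tuple tnth m (lift ord0 i) | i < n].
rewrite ge0_integral_lebesgue_rspaceS; last 2 first.
- apply/measurable_EFinP; apply: measurable_funM.
    by apply: measurableT_comp => //; exact: measurable_tnth.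
  exact: measurable_gaussian_pdf.
- by move=> x; rewrite lee_fin mulr_ge0// gaussian_pdf_ge0.
apply: eq_integral => t _.
transitivity (\int[lebesgue_rspace R n]_x
    ((g t * normal_pdf (tnth m ord0) s t)%:E * (gaussian_pdf m' s x)%:E)).
  apply: eq_integral => x _; rewrite -EFinM -mulrA; congr (_ * _)%:E.
  rewrite /gaussian_pdf big_ord_recl; congr (_ * _)%R.
  by apply: eq_bigr => i _; rewrite tnth_mktuple tnthS.
rewrite ge0_integralZl//.
- by rewrite integral_gaussian_pdf mule1.
- by apply/measurable_EFinP; apply: measurable_gaussian_pdf.
- by move=> x _; rewrite lee_fin gaussian_pdf_ge0.
- by rewrite lee_fin mulr_ge0// normal_pdf_ge0.
Qed.

(** Doubling the standard deviation replaces [exp (- z^2 / 2)] by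
    [exp (- z^2 / 8)], where [z = (t - m) / s]; the factor gained,
    [exp (3 z^2 / 8)], is at least [1 + 3 z^2 / 8] and absorbs the square. It
    turns second moments into total masses, without integrating by parts. *)
Lemma sqr_normal_pdf_le (m s t : R) : s != 0%R ->
  ((t - m) ^+ 2 * normal_pdf m s t <= 6 * s ^+ 2 * normal_pdf m (2 * s) t)%R.
Proof.
move=> s0; have s20 : (0 < s ^+ 2)%R by rewrite exprn_even_gt0.
have s2 : (2 * s != 0)%R by rewrite mulf_neq0// pnatr_eq0.
rewrite !normal_pdfE// /normal_peak /normal_fun.
have -> : ((2 * s) ^+ 2 = 2 ^+ 2 * s ^+ 2)%R by rewrite exprMn.
have -> : (Num.sqrt (2 ^+ 2 * s ^+ 2 * pi *+ 2) =
          2 * Num.sqrt (s ^+ 2 * pi *+ 2))%R.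
  by rewrite -mulrA -mulrnAr sqrtrM ?sqr_ge0// sqrtr_sqr ger0_norm.
set P := Num.sqrt _; set u := (t - m)%R.
have P0 : (0 < P)%R by rewrite sqrtr_gt0 mulrn_wgt0// mulr_gt0// pi_gt0.
(* z is the square of the standardized variable *)
set z := (u ^+ 2 / s ^+ 2)%R.
have uz : (u ^+ 2 = z * s ^+ 2)%R by rewrite /z divfK// gt_eqF.
have -> : (- u ^+ 2 / (s ^+ 2 *+ 2) = - z / 8 - 3 / 8 * z)%R.
  by rewrite uz; field.
have -> : (- u ^+ 2 / (2 ^+ 2 * s ^+ 2 *+ 2) = - z / 8)%R.
  by rewrite uz; field.
rewrite expRD uz expRN.
have E0 := expR_gt0 (- z / 8); have F0 := expR_gt0 (3 / 8 * z).
have := expR_ge1Dx (3 / 8 * z).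
move: (expR _) (expR (3 / 8 * z)) E0 F0 => E F E0 F0 zF.
have -> : (z * s ^+ 2 * (P^-1 * (E * F^-1)) = s ^+ 2 * P^-1 * E * (z / F))%R by ring.
have -> : (6 * s ^+ 2 * ((2 * P)^-1 * E) = s ^+ 2 * P^-1 * E * 3)%R.
  by field; rewrite gt_eqF.
rewrite ler_wpM2l//; last by rewrite ler_pdivrMr//; lra.
by apply: mulr_ge0; [apply: divr_ge0|]; exact: ltW.
Qed.

End gaussian_integrals.

Section normal_second_moment.
Context (R : realType).
Local Open Scope ereal_scope.

Lemma normal_second_moment_le (m s : R) : s != 0%R ->
  \int[@lebesgue_measure R]_t ((t - m) ^+ 2 * normal_pdf m s t)%:E <=
  (6 * s ^+ 2)%:E.
Proof.
move=> s0.
have m0 r : measurable_fun [set: R] (normal_pdf m r) by exact: measurable_normal_pdf.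
apply: (@le_trans _ _ (\int[@lebesgue_measure R]_t
    ((6 * s ^+ 2)%:E * (normal_pdf m (2 * s) t)%:E))).
  apply: ge0_le_integral => //.
  - by move=> t _; rewrite lee_fin mulr_ge0 ?sqr_ge0 ?normal_pdf_ge0.
  - apply/measurable_EFinP; apply: measurable_funM; last exact: m0.
    by apply: measurable_funX; apply: measurable_funB.
  - by apply: emeasurable_funM => //; apply/measurable_EFinP; exact: m0.
  - by move=> t _; rewrite -EFinM lee_fin sqr_normal_pdf_le.
rewrite ge0_integralZl//.
- by rewrite integral_normal_pdf mule1.
- by apply/measurable_EFinP; exact: m0.
- by move=> t _; rewrite lee_fin normal_pdf_ge0.
- by rewrite lee_fin mulr_ge0// sqr_ge0.
Qed.

End normal_second_moment.

(** * Reversibility and the Dirichlet form *)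

Section symmetrization.
Context d (T : measurableType d) (R : realType).
Context (mu : {sigma_finite_measure set T -> \bar R}).
Local Open Scope ereal_scope.

(** Exchanging the two variables leaves [w] and, by Fubini, the integral
    unchanged; averaging the two expressions produces the square. The bounds on
    [f] make each of them integrable. *)
Lemma integral_symmetric_dirichlet (w : T * T -> R) (f : T -> R) :
  (mu \x mu).-integrable [set: T * T] (EFin \o w) ->
  (forall z, w (z.2, z.1) = w z) ->
  measurable_fun [set: T] f -> (forall x, (0 <= f x <= 1)%R) ->
  \int[mu]_x \int[mu]_y (w (x, y) * (f x * (f x - f y)))%:E =
  (2^-1)%:E * \int[mu \x mu]_z (w z * (f z.1 - f z.2) ^+ 2)%:E.
Proof.
move=> iw wS mf f01.
pose g (z : T * T) : R := (f z.1 * (f z.1 - f z.2))%R.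
pose g' (z : T * T) : R := (f z.2 * (f z.2 - f z.1))%R.
have mf1 : measurable_fun [set: T * T] (fun z => f z.1).
  exact: measurableT_comp mf measurable_fst.
have mf2 : measurable_fun [set: T * T] (fun z => f z.2).
  exact: measurableT_comp mf measurable_snd.
have mw : measurable_fun [set: T * T] w.
  by apply/measurable_EFinP; exact: (measurable_int _ iw).
have mg : measurable_fun [set: T * T] g.
  by apply: measurable_funM => //; exact: measurable_funB.
have mg' : measurable_fun [set: T * T] g'.
  by apply: measurable_funM => //; exact: measurable_funB.
have g1 z : (`|g z| <= 1)%R.
  rewrite /g normrM; have /andP[a0 a1] := f01 z.1; have /andP[b0 b1] := f01 z.2.
  by rewrite mulr_ile1// ler_norml; lra.
have iwg : (mu \x mu).-integrable [set: T * T] (fun z => (w z * g z)%:E).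
  apply: le_integrable iw => //; first exact/measurable_EFinP/measurable_funM.
  by move=> z _; rewrite !abse_EFin lee_fin normrM ler_piMr.
have iwg' : (mu \x mu).-integrable [set: T * T] (fun z => (w z * g' z)%:E).
  apply: le_integrable iw => //; first exact/measurable_EFinP/measurable_funM.
  by move=> z _; rewrite !abse_EFin lee_fin normrM ler_piMr// (g1 (z.2, z.1)).
have E1 := integral12_prod_meas1 iwg.
have E2 := integral21_prod_meas1 iwg'.
rewrite /fubini_F /= in E1; rewrite /fubini_G /= in E2.
have E12 : \int[mu]_y \int[mu]_x (w (x, y) * g' (x, y))%:E =
   \int[mu]_y \int[mu]_x (w (y, x) * g (y, x))%:E.
  by apply: eq_integral => y _; apply: eq_integral => x _; rewrite -[w (y, x)]wS.
have E3 : \int[mu \x mu]_z (w z * g z)%:E = \int[mu \x mu]_z (w z * g' z)%:E.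
  by rewrite -E1 -E2 E12.
have fin : \int[mu \x mu]_z (w z * g z)%:E \is a fin_num by exact: integrable_fin_num.
have -> : \int[mu \x mu]_z (w z * (f z.1 - f z.2) ^+ 2)%:E =
   \int[mu \x mu]_z ((w z * g z)%:E + (w z * g' z)%:E).
  by apply: eq_integral => z _; rewrite -EFinD /g /g'; congr EFin; ring.
rewrite (integralD measurableT iwg iwg') -E3.
transitivity (\int[mu \x mu]_z (w z * g z)%:E); first exact: E1.
rewrite -(fineK fin) -EFinD -EFinM; congr EFin; lra.
Qed.

End symmetrization.

Section mala_flow.
Context (R : realType) (d : nat) (h : R).
Local Notation mu := (lebesgue_rspace R d).
Implicit Types (x y : rspace R d) (f : rspace R d -> R).

Definition mala_move_pdf x y : R := mala_proposal_pdf h x y * mala_accept h x y.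

(** The joint density of the current and the next state of the stationary chain
    on the event that the proposal is accepted. *)
Definition mala_flow (z : rspace R d * rspace R d) : R :=
  mala_target_pdf z.1 * mala_move_pdf z.1 z.2.

Lemma mala_move_pdf_ge0 x y : 0 <= mala_move_pdf x y.
Proof. by rewrite mulr_ge0 ?mala_proposal_pdf_ge0 ?mala_accept_ge0. Qed.

Lemma mala_move_pdf_le x y : mala_move_pdf x y <= mala_proposal_pdf h x y.
Proof. by rewrite ler_piMr ?mala_proposal_pdf_ge0 ?mala_accept_le1. Qed.

Lemma mala_target_pdf_ge0 x : 0 <= mala_target_pdf x.
Proof. exact: gaussian_pdf_ge0. Qed.

Lemma mala_flow_ge0 z : 0 <= mala_flow z.
Proof. by rewrite mulr_ge0 ?mala_target_pdf_ge0 ?mala_move_pdf_ge0. Qed.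

Lemma gaussian_pdf_gt0 (m : rspace R d) (s : R) x : s != 0 -> 0 < gaussian_pdf m s x.
Proof.
move=> s0; apply: prodr_gt0 => i _; rewrite normal_pdfE//.
by rewrite mulr_gt0 ?normal_peak_gt0// expR_gt0.
Qed.

(** Detailed balance: the acceptance ratio is designed so that the flow is the
    minimum of [pi(x) Q(x, y)] and [pi(y) Q(y, x)]. *)
Lemma mala_flow_sym : 0 < h -> forall z, mala_flow (z.2, z.1) = mala_flow z.
Proof.
move=> h0 [x y] /=.
have s0 : Num.sqrt (2 * h) != 0 by rewrite gt_eqF// sqrtr_gt0 mulr_gt0.
have flowE u v : mala_flow (u, v) =
    Num.min (mala_target_pdf u * mala_proposal_pdf h u v)
            (mala_target_pdf v * mala_proposal_pdf h v u).
  have p0 : 0 < mala_target_pdf u * mala_proposal_pdf h u v.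
    by apply: mulr_gt0; apply: gaussian_pdf_gt0 => //; exact: oner_neq0.
  rewrite /mala_flow /mala_move_pdf /mala_accept /= mulrA minr_pMr; last exact: ltW.
  by rewrite mulr1 mulrCA divff ?gt_eqF// mulr1.
by rewrite !flowE minC.
Qed.

Lemma measurable_mala_target_pdf :
  measurable_fun [set: rspace R d] (@mala_target_pdf R d).
Proof. exact: measurable_gaussian_pdf. Qed.

Lemma measurable_mala_proposal_pdf : measurable_fun [set: rspace R d * rspace R d]
  (fun z => mala_proposal_pdf h z.1 z.2).
Proof.
apply: measurable_prod => i _.
under eq_fun do rewrite tnth_mktuple.
have mi1 : measurable_fun setT
    (fun z : rspace R d * rspace R d => tnth z.1 i : measurableTypeR R).
  exact: measurableT_comp (measurable_tnth i) measurable_fst.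
have mi2 : measurable_fun setT
    (fun z : rspace R d * rspace R d => tnth z.2 i : measurableTypeR R).
  exact: measurableT_comp (measurable_tnth i) measurable_snd.
have [s0|s0] := eqVneq (Num.sqrt (2 * h)) 0.
  under eq_fun do rewrite /normal_pdf s0 eqxx.
  rewrite (_ : (fun _ => _) =
    \1_`[0%R, 1%R] \o (fun z : rspace R d * rspace R d => tnth z.2 i))//.
  by apply: measurableT_comp; [exact: measurable_indic|exact: mi2].
rewrite (_ : (fun _ => _) =
    normal_pdf 0 (Num.sqrt (2 * h)) \o
      (fun z : rspace R d * rspace R d => tnth z.2 i - (1 - h) * tnth z.1 i)).
  apply: measurableT_comp; first exact: measurable_normal_pdf.
  apply: measurable_funB => //; exact: measurable_funM.
apply/funext => z /=; rewrite !normal_pdfE// /normal_fun.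
by rewrite subr0.
Qed.

Lemma measurable_mala_move_pdf : measurable_fun [set: rspace R d * rspace R d]
  (fun z => mala_move_pdf z.1 z.2).
Proof.
have mp1 : measurable_fun [set: rspace R d * rspace R d]
    (fun z => mala_target_pdf z.1).
  exact: measurableT_comp measurable_mala_target_pdf measurable_fst.
have mp2 : measurable_fun [set: rspace R d * rspace R d]
    (fun z => mala_target_pdf z.2).
  exact: measurableT_comp measurable_mala_target_pdf measurable_snd.
have mq := measurable_mala_proposal_pdf.
have mq' : measurable_fun [set: rspace R d * rspace R d]
    (fun z => mala_proposal_pdf h z.2 z.1).
  exact: measurableT_comp mq (@measurable_swap _ _ _ _).
apply: measurable_funM => //; apply: measurable_minr => //; apply: measurable_funM.
  exact: measurable_funM.
under eq_fun do rewrite -powR_inv1 ?mulr_ge0 ?gaussian_pdf_ge0//.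
apply: (measurableT_comp (measurable_powR _)).
exact: measurable_funM.
Qed.

Lemma measurable_mala_flow : measurable_fun [set: rspace R d * rspace R d] mala_flow.
Proof.
apply: measurable_funM; last exact: measurable_mala_move_pdf.
exact: measurableT_comp measurable_mala_target_pdf measurable_fst.
Qed.

Lemma measurable_mala_move_pdfr x : measurable_fun [set: rspace R d] (mala_move_pdf x).
Proof.
exact: measurableT_comp measurable_mala_move_pdf (measurable_pair1 x).
Qed.

Local Open Scope ereal_scope.

Lemma integral_mala_move_pdf_le1 x : \int[mu]_y (mala_move_pdf x y)%:E <= 1.
Proof.
rewrite -(integral_gaussian_pdf [tuple ((1 - h) * tnth x i)%R | i < d] (Num.sqrt (2 * h))).
apply: ge0_le_integral => //.
- by move=> y _; rewrite lee_fin mala_move_pdf_ge0.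
- by apply/measurable_EFinP; exact: measurable_mala_move_pdfr.
- by apply/measurable_EFinP; apply: measurable_gaussian_pdf.
- by move=> y _; rewrite lee_fin mala_move_pdf_le.
Qed.

Lemma integrable_mala_move_pdf x :
  mu.-integrable [set: rspace R d] (EFin \o mala_move_pdf x).
Proof.
apply/integrableP; split; first by apply/measurable_EFinP; exact: measurable_mala_move_pdfr.
under eq_integral do rewrite /= ger0_norm ?mala_move_pdf_ge0//.
by rewrite (le_lt_trans (integral_mala_move_pdf_le1 x))// ltry.
Qed.

Lemma integrable_mala_flow :
  (mu \x mu).-integrable [set: rspace R d * rspace R d] (EFin \o mala_flow).
Proof.
apply/integrable12ltyP; first by apply/measurable_EFinP; exact: measurable_mala_flow.
apply: (@le_lt_trans _ _ (\int[mu]_x (mala_target_pdf x)%:E)); last first.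
  by rewrite integral_gaussian_pdf ltry.
apply: ge0_le_integral => //.
- by move=> x _; apply: integral_ge0.
- have := @measurable_fun_fubini_tonelli_F _ _ _ _ _ mu (abse \o (EFin \o mala_flow)).
  apply; last by move=> z; exact: abse_ge0.
  by apply: measurableT_comp => //; apply/measurable_EFinP; exact: measurable_mala_flow.
- by apply/measurable_EFinP; exact: measurable_mala_target_pdf.
- move=> x _.
  under eq_integral do rewrite /= ger0_norm ?mala_flow_ge0// /mala_flow /= EFinM.
  rewrite ge0_integralZl//.
  + rewrite -[leRHS]mule1 lee_wpmul2l ?lee_fin ?mala_target_pdf_ge0//.
    exact: integral_mala_move_pdf_le1.
  + by apply/measurable_EFinP; exact: measurable_mala_move_pdfr.
  + by move=> y _; rewrite lee_fin mala_move_pdf_ge0.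
  + by rewrite lee_fin mala_target_pdf_ge0.
Qed.

(** The kernel is the sum of the measure of density [mala_move_pdf h x] and of
    a Dirac mass at [x] weighted by the rejection probability. *)
Lemma ge0_integral_mala_kernel x f :
  measurable_fun [set: rspace R d] f -> (forall y, (0 <= f y)%R) ->
  \int[mala_kernel h x]_y (f y)%:E =
  \int[mu]_y (mala_move_pdf x y * f y)%:E +
  (1 - \int[mu]_y (mala_move_pdf x y)%:E) * (f x)%:E.
Proof.
move=> mf f0.
set a := \int[mu]_y (mala_move_pdf x y)%:E.
have a1 : a <= 1 := integral_mala_move_pdf_le1 x.
have a0 : 0 <= a by apply: integral_ge0 => y _; rewrite lee_fin mala_move_pdf_ge0.
have afin : a \is a fin_num by rewrite ge0_fin_numE// (le_lt_trans a1)// ltry.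
have rfin : 1 - a \is a fin_num by rewrite fin_numB afin.
have r0 : (0 <= fine (1 - a))%R by rewrite fine_ge0// sube_ge0// afin.
rewrite (eq_measure_integral (measure_add
  (density_measure mu (measurable_mala_move_pdfr x) (mala_move_pdf_ge0 x))
  (mscale (NngNum r0) \d_x))); last first.
  move=> A mA _; rewrite [RHS]measure_addE /= /mala_kernel; congr (_ + _).
  by rewrite /mscale /= fineK// muleC diracE indicE.
have mEf : measurable_fun [set: rspace R d] (EFin \o f) by exact/measurable_EFinP.
have f0E y : [set: rspace R d] y -> 0 <= (f y)%:E by rewrite lee_fin.
rewrite ge0_integral_measure_add// ge0_integral_density_measure//.
rewrite ge0_integral_mscale// integral_dirac// diracT mul1e fineK//.
by congr (_ + _); apply: eq_integral => y _; rewrite -EFinM mulrC.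
Qed.

(** On rejection the chain stays at [x], where the increment of [f] is zero. *)
Lemma sub_mala_op x f :
  measurable_fun [set: rspace R d] f -> (forall y, (0 <= f y <= 1)%R) ->
  (f x - mala_op h f x)%:E = \int[mu]_y (mala_move_pdf x y * (f x - f y))%:E.
Proof.
move=> mf f01.
have f0 y : (0 <= f y)%R by case/andP: (f01 y).
have f1 y : (f y <= 1)%R by case/andP: (f01 y).
have ik := integrable_mala_move_pdf x.
have mk := measurable_mala_move_pdfr x.
have ikf : mu.-integrable [set: rspace R d] (fun y => (mala_move_pdf x y * f y)%:E).
  apply: le_integrable ik => //; first by apply/measurable_EFinP; exact: measurable_funM.
  by move=> y _; rewrite !abse_EFin lee_fin normrM ler_piMr// ger0_norm.
have ikfx : mu.-integrable [set: rspace R d] (fun y => (f x)%:E * (mala_move_pdf x y)%:E).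
  exact: integrableZl.
rewrite /mala_op /Rintegral ge0_integral_mala_kernel//.
have fa := integrable_fin_num measurableT ik.
have fb := integrable_fin_num measurableT ikf.
transitivity (\int[mu]_y ((f x)%:E * (mala_move_pdf x y)%:E -
    (mala_move_pdf x y * f y)%:E)); last first.
  by apply: eq_integral => y _; rewrite -EFinM -EFinB; congr EFin; ring.
rewrite (integralB measurableT ikfx ikf) (integralZl measurableT ik).
move: fa fb; rewrite /comp; set a := integral _ _ _; set b := integral _ _ _.
move=> /fineK <- /fineK <-; rewrite /= -!EFinM -EFinB; congr EFin; ring.
Qed.

Lemma measurable_mala_op f :
  measurable_fun [set: rspace R d] f -> (forall y, (0 <= f y)%R) ->
  measurable_fun [set: rspace R d] (mala_op h f).
Proof.
move=> mf f0.
have mk2 := measurable_mala_move_pdf.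
have mf2 : measurable_fun [set: rspace R d * rspace R d] (fun z => f z.2).
  exact: measurableT_comp mf measurable_snd.
have mf' : measurable_fun [set: rspace R d] (fun x => (f x)%:E).
  exact/measurable_EFinP.
have ma : measurable_fun [set: rspace R d]
    (fun x => \int[mu]_y (mala_move_pdf x y)%:E).
  apply: (measurable_fun_fubini_tonelli_F
    (fun z : rspace R d * rspace R d => (mala_move_pdf z.1 z.2)%:E)) => //.
    exact/measurable_EFinP.
  by move=> z; rewrite lee_fin mala_move_pdf_ge0.
have mb : measurable_fun [set: rspace R d]
    (fun x => \int[mu]_y (mala_move_pdf x y * f y)%:E).
  apply: (measurable_fun_fubini_tonelli_F
    (fun z : rspace R d * rspace R d => (mala_move_pdf z.1 z.2 * f z.2)%:E)) => //.
    by apply/measurable_EFinP; exact: measurable_funM.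
  by move=> z; rewrite lee_fin mulr_ge0// mala_move_pdf_ge0.
rewrite (_ : mala_op h f = fine \o (fun x =>
    \int[mu]_y (mala_move_pdf x y * f y)%:E +
    (1 - \int[mu]_y (mala_move_pdf x y)%:E) * (f x)%:E)); last first.
  by apply/funext => x; rewrite /mala_op /Rintegral ge0_integral_mala_kernel.
apply: measurableT_comp; first exact: fine_measurable.
apply: emeasurable_funD => //.
by apply: emeasurable_funM => //; exact: emeasurable_funB.
Qed.

Lemma mala_dirichletE f : (0 < h)%R ->
  measurable_fun [set: rspace R d] f -> (forall y, (0 <= f y <= 1)%R) ->
  mala_dirichlet h f f =
  (2^-1)%:E * \int[mu \x mu]_z (mala_flow z * (f z.1 - f z.2) ^+ 2)%:E.
Proof.
move=> h0 mf f01.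
rewrite -(integral_symmetric_dirichlet integrable_mala_flow (mala_flow_sym h0) mf f01).
have f0 y : (0 <= f y)%R by case/andP: (f01 y).
have mTf := measurable_mala_op mf f0.
rewrite /mala_dirichlet unlock integral_gaussian; last first.
  apply/measurable_EFinP; apply: measurable_funM => //; exact: measurable_funB.
apply: eq_integral => x _.
transitivity ((mala_target_pdf x * f x)%:E *
    \int[mu]_y (mala_move_pdf x y * (f x - f y))%:E).
  by rewrite -sub_mala_op// -!EFinM; congr EFin; rewrite /= mulrC mulrA.
rewrite -integralZl//.
  apply: eq_integral => y _; rewrite -EFinM /mala_flow /=; congr EFin; ring.
apply: le_integrable (integrable_mala_move_pdf x) => //.
  apply/measurable_EFinP; apply: measurable_funM => //.
    exact: measurable_mala_move_pdfr.
  exact: measurable_funB.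
move=> y _; rewrite !abse_EFin lee_fin normrM ler_piMr// ler_norml.
have := f01 x; have := f01 y; lra.
Qed.

End mala_flow.

(** * The test function *)

Section clip.
Context (R : realType).

Definition clip (t : R) : R := Num.max 0 (Num.min t 1).

Lemma clip_itv t : 0 <= clip t <= 1.
Proof. by rewrite /clip le_max lexx ge_max ler01 ge_min lexx orbT. Qed.

Lemma sqr_clipB_le u t : (clip u - clip t) ^+ 2 <= (u - t) ^+ 2.
Proof.
rewrite -(real_normK (num_real (u - t))).
rewrite -(real_normK (num_real (clip u - clip t))) ler_sqr ?nnegrE//.
have := ler_norm (u - t); have := ler_norm (- (u - t)); rewrite normrN /clip.
case: (leP t 1) => ?; case: (leP u 1) => ?; case: (leP 0 t) => ?;
  case: (leP 0 u) => ?; case: (leP (0 : R) 1) => ?; rewrite ler_norml; lra.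
Qed.

Lemma measurable_clip : measurable_fun [set: R] clip.
Proof. by apply: measurable_maxr => //; exact: measurable_minr. Qed.

End clip.

Section clip_head.
Context (R : realType) (n : nat).
Local Open Scope ereal_scope.

Definition clip_head (x : rspace R n.+1) : R := clip (tnth x ord0).

Lemma measurable_clip_head : measurable_fun [set: rspace R n.+1] clip_head.
Proof. exact: measurableT_comp (@measurable_clip R) (measurable_tnth ord0). Qed.

Lemma clip_head_itv x : (0 <= clip_head x <= 1)%R.
Proof. exact: clip_itv. Qed.

Lemma clip_head_Lfun (P : probability (rspace R n.+1) R) :
  clip_head \in Lfun P 2%:E.
Proof.
rewrite inE/=; apply/andP; split; rewrite inE//=.
  exact: measurable_clip_head.
rewrite /finite_norm unlock poweR_lty//.
apply/integrable_lty => //.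
apply: (@le_integrable _ _ _ P _ measurableT _ (EFin \o cst 1%R)); last first.
- exact: finite_measure_integrable_cst.
- move=> x _; have /andP[c0 c1] := clip_head_itv x.
  rewrite /= lee_fin (ger0_norm (powR_ge0 _ _)) (ger0_norm c0) powR_mulrn//.
  by rewrite normr1 exprn_ile1.
- apply/measurable_EFinP; apply: (measurableT_comp (measurable_powR _)).
  by apply: measurableT_comp => //; exact: measurable_clip_head.
Qed.

Lemma integral_sqr_clip_normal_le1 (u m s : R) :
  \int[@lebesgue_measure R]_t ((clip u - clip t) ^+ 2 * normal_pdf m s t)%:E <= 1.
Proof.
rewrite -(integral_normal_pdf m s); apply: ge0_le_integral => //.
- by move=> t _; rewrite lee_fin mulr_ge0 ?sqr_ge0 ?normal_pdf_ge0.
- apply/measurable_EFinP; apply: measurable_funM; last exact: measurable_normal_pdf.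
  by apply: measurable_funX; apply: measurable_funB => //; exact: measurable_clip.
- by apply/measurable_EFinP; exact: measurable_normal_pdf.
- move=> t _; rewrite lee_fin ler_piMl ?normal_pdf_ge0//.
  have := clip_itv u; have := clip_itv t => /andP[? ?] /andP[? ?].
  rewrite -(real_normK (num_real _)) exprn_ile1//.
  by rewrite ler_norml; lra.
Qed.

(** From [u - t = h u - (t - (1 - h) u)] and [(a - b)^2 <= 2 a^2 + 2 b^2]; the
    constant 24 is twice the factor 6 of the second moment bound, times the
    factor 2 of the variance [2h]. *)
Lemma integral_sqr_clip_normal_le (h u : R) : (0 < h)%R ->
  \int[@lebesgue_measure R]_t
    ((clip u - clip t) ^+ 2 * normal_pdf ((1 - h) * u) (Num.sqrt (2 * h)) t)%:E
  <= (24 * h + 2 * h ^+ 2 * u ^+ 2)%:E.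
Proof.
move=> h0; set m := ((1 - h) * u)%R; set s := Num.sqrt (2 * h).
have s20 : (s ^+ 2 = 2 * h)%R by rewrite sqr_sqrtr// mulr_ge0// ltW.
have s0 : (s != 0)%R by rewrite gt_eqF// sqrtr_gt0 mulr_gt0.
have mN : measurable_fun [set: R] (normal_pdf m s) by exact: measurable_normal_pdf.
have N0 := normal_pdf_ge0 m s.
have mA : measurable_fun [set: R] (fun t => ((t - m) ^+ 2 * normal_pdf m s t)%:E).
  apply/measurable_EFinP; apply: measurable_funM; last exact: mN.
  by apply: measurable_funX; apply: measurable_funB.
have mB : measurable_fun [set: R] (fun t => (normal_pdf m s t)%:E).
  exact/measurable_EFinP.
have A0 t : 0 <= ((t - m) ^+ 2 * normal_pdf m s t)%:E.
  by rewrite lee_fin mulr_ge0 ?sqr_ge0.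
have B0 t : 0 <= (normal_pdf m s t)%:E by rewrite lee_fin.
have c0 : 0 <= (2 * h ^+ 2 * u ^+ 2)%:E.
  by rewrite lee_fin; apply: mulr_ge0; [apply: mulr_ge0|]; rewrite ?sqr_ge0.
apply: (@le_trans _ _ (\int[@lebesgue_measure R]_t
    (2%:E * ((t - m) ^+ 2 * normal_pdf m s t)%:E +
     (2 * h ^+ 2 * u ^+ 2)%:E * (normal_pdf m s t)%:E))).
  apply: ge0_le_integral => //.
  - by move=> t _; rewrite lee_fin mulr_ge0 ?sqr_ge0.
  - apply/measurable_EFinP; apply: measurable_funM; last exact: mN.
    apply: measurable_funX; apply: measurable_funB => //; exact: measurable_clip.
  - by apply: emeasurable_funD; apply: emeasurable_funM.
  - move=> t _; rewrite -!EFinM -EFinD lee_fin mulrA -mulrDl ler_wpM2r//.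
    apply: le_trans (sqr_clipB_le u t) _.
    have -> : (2 * h ^+ 2 * u ^+ 2 = 2 * (h * u) ^+ 2)%R by ring.
    have -> : (u - t = h * u - (t - m))%R by rewrite /m; ring.
    have := sqr_ge0 (h * u + (t - m))%R; rewrite -subr_ge0.
    move: (h * u)%R (t - m)%R => a b; nra.
rewrite ge0_integralD//.
- rewrite !ge0_integralZl// integral_normal_pdf mule1 [leRHS]EFinD leeD2r//.
  apply: le_trans (lee_wpmul2l _ (normal_second_moment_le m s0)) _ => //.
  by rewrite -EFinM lee_fin s20; lra.
- by move=> t _; rewrite mule_ge0.
- exact: emeasurable_funM.
- by move=> t _; rewrite mule_ge0.
- exact: emeasurable_funM.
Qed.

(** The bound on the one-dimensional increment is a parameter because two
    regimes need different ones: [K = 24h] and [L = 2h^2] for small steps,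
    [K = 1] and [L = 0] for large ones. *)
Lemma mala_dirichlet_clip_head_le (h K L : R) : (0 < h)%R ->
  (0 <= K)%R -> (0 <= L)%R ->
  (forall u, \int[@lebesgue_measure R]_t
    ((clip u - clip t) ^+ 2 * normal_pdf ((1 - h) * u) (Num.sqrt (2 * h)) t)%:E
    <= (K + L * u ^+ 2)%:E) ->
  mala_dirichlet h clip_head clip_head <= (2^-1 * (K + 6 * L))%:E.
Proof.
move=> h0 K0 L0 KL.
have mf := measurable_clip_head.
rewrite (mala_dirichletE h0 mf clip_head_itv) EFinM lee_wpmul2l ?lee_fin ?invr_ge0//.
have mg (u : R) : measurable_fun [set: R] (fun t => (clip u - clip t) ^+ 2)%R.
  by apply: measurable_funX; apply: measurable_funB => //; exact: measurable_clip.
have mKL : measurable_fun [set: R] (fun t => K + L * t ^+ 2)%R.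
  by apply: measurable_funD => //; apply: measurable_funM.
have KL0 (t : R) : (0 <= K + L * t ^+ 2)%R.
  by rewrite addr_ge0// mulr_ge0// sqr_ge0.
have mI : measurable_fun [set: rspace R n.+1 * rspace R n.+1]
    (fun z => (mala_flow h z * (clip_head z.1 - clip_head z.2) ^+ 2)%:E).
  apply/measurable_EFinP; apply: measurable_funM; first exact: measurable_mala_flow.
  apply: measurable_funX; apply: measurable_funB.
    exact: measurableT_comp mf measurable_fst.
  exact: measurableT_comp mf measurable_snd.
have I0 z : 0 <= (mala_flow h z * (clip_head z.1 - clip_head z.2) ^+ 2)%:E.
  by rewrite lee_fin mulr_ge0 ?sqr_ge0 ?mala_flow_ge0.
rewrite fubini_tonelli1//.
(* integrate y out, bounding the acceptance probability by 1 *)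
apply: (@le_trans _ _ (\int[lebesgue_rspace R n.+1]_x
   (((K + L * tnth x ord0 ^+ 2) * gaussian_pdf (origin R n.+1) 1 x)%:E))).
  apply: ge0_le_integral => //.
  - by move=> x _; apply: integral_ge0 => y _.
  - exact: measurable_fun_fubini_tonelli_F.
  - apply/measurable_EFinP; apply: measurable_funM; last exact: measurable_gaussian_pdf.
    exact: measurableT_comp mKL (measurable_tnth ord0).
  - move=> x _.
    have mG : measurable_fun [set: rspace R n.+1]
      (fun y => ((clip (tnth x ord0) - clip (tnth y ord0)) ^+ 2 *
      gaussian_pdf [tuple ((1 - h) * tnth x i)%R | i < n.+1] (Num.sqrt (2 * h)) y)%:E).
      apply/measurable_EFinP; apply: measurable_funM; last exact: measurable_gaussian_pdf.
      exact: measurableT_comp (mg _) (measurable_tnth ord0).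
    apply: (@le_trans _ _ (\int[lebesgue_rspace R n.+1]_y
      ((mala_target_pdf x)%:E * ((clip (tnth x ord0) - clip (tnth y ord0)) ^+ 2 *
      gaussian_pdf [tuple ((1 - h) * tnth x i)%R | i < n.+1] (Num.sqrt (2 * h)) y)%:E))).
      apply: ge0_le_integral => //.
      + exact: measurableT_comp mI (measurable_pair1 x).
      + exact: emeasurable_funM.
      + move=> y _; rewrite -EFinM lee_fin /mala_flow /= -mulrA.
        rewrite ler_wpM2l ?mala_target_pdf_ge0// mulrC ler_wpM2l ?sqr_ge0//.
        exact: mala_move_pdf_le.
    rewrite ge0_integralZl//; last 2 first.
    + by move=> y _; rewrite lee_fin mulr_ge0 ?sqr_ge0 ?gaussian_pdf_ge0.
    + by rewrite lee_fin mala_target_pdf_ge0.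
    rewrite (integral_gaussian_head _ _ (mg (tnth x ord0))); last first.
      by move=> t; exact: sqr_ge0.
    rewrite [(_ * gaussian_pdf _ _ x)%R]mulrC EFinM.
    rewrite lee_wpmul2l ?lee_fin ?mala_target_pdf_ge0//.
    by rewrite tnth_mktuple; exact: KL.
rewrite (integral_gaussian_head _ _ mKL)//.
rewrite tnth_mktuple.
have mN : measurable_fun [set: R] (fun t => (normal_pdf 0 1 t)%:E).
  by apply/measurable_EFinP; exact: measurable_normal_pdf.
have mA : measurable_fun [set: R] (fun t => ((t - 0) ^+ 2 * normal_pdf 0 1 t)%:E).
  apply/measurable_EFinP; apply: measurable_funM; last exact: measurable_normal_pdf.
  by apply: measurable_funX; apply: measurable_funB.
have A0 t : 0 <= ((t - 0) ^+ 2 * normal_pdf 0 1 t : R)%:E.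
  by rewrite lee_fin mulr_ge0 ?sqr_ge0 ?normal_pdf_ge0.
rewrite [leLHS](_ : _ = \int[@lebesgue_measure R]_t (K%:E * (normal_pdf 0 1 t)%:E +
    L%:E * ((t - 0) ^+ 2 * normal_pdf 0 1 t)%:E)); last first.
  by apply: eq_integral => t _; rewrite -!EFinM -EFinD; congr EFin; ring.
have N0 t : 0 <= (normal_pdf 0 1 t : R)%:E by rewrite lee_fin normal_pdf_ge0.
rewrite ge0_integralD//.
- rewrite !ge0_integralZl ?lee_fin// integral_normal_pdf mule1 EFinD leeD2l//.
  apply: le_trans (lee_wpmul2l _ (normal_second_moment_le 0 (oner_neq0 R))) _.
    by rewrite lee_fin.
  by rewrite -EFinM lee_fin expr1n mulr1 mulrC.
- by move=> t _; rewrite mule_ge0// lee_fin.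
- exact: emeasurable_funM.
- by move=> t _; rewrite mule_ge0// lee_fin.
- exact: emeasurable_funM.
Qed.

(** Whatever the mean [m], the integrand is [m^2] on the interval [-1, 0] and
    [(1 - m)^2] on the interval [1, 2], on both of which the normal density
    is at least its value at 2; and [m^2 + (1 - m)^2 >= 1/2]. *)
Lemma variance_clip_head_ge :
  (normal_pdf 0 1 (2 : R) / 2)%:E <= 'V_(mala_target R n.+1)[clip_head].
Proof.
rewrite /variance !unlock; set m := fine _.
have mg : measurable_fun [set: R] (fun t => (clip t - m) ^+ 2)%R.
  by apply: measurable_funX; apply: measurable_funB => //; exact: measurable_clip.
rewrite ge0_integral_gaussian; last 2 first.
- apply/measurable_EFinP.
  exact: measurableT_comp mg (measurable_tnth ord0).
- by move=> x; rewrite lee_fin -expr2 sqr_ge0.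
rewrite [leRHS](_ : _ = \int[lebesgue_rspace R n.+1]_x
    ((clip (tnth x ord0) - m) ^+ 2 * gaussian_pdf (origin R n.+1) 1 x)%:E); last first.
  by apply: eq_integral => x _; rewrite -EFinM -expr2.
rewrite (integral_gaussian_head _ _ mg); last by move=> t; exact: sqr_ge0.
rewrite tnth_mktuple; set k := normal_pdf 0 1 (2 : R).
have k0 : (0 <= k)%R by exact: normal_pdf_ge0.
have kN t : (- 2 <= t <= 2)%R -> (k <= normal_pdf 0 1 t)%R.
  move=> t2; rewrite /k normal_pdfE ?oner_neq0// /normal_fun.
  rewrite ler_wpM2l ?normal_peak_ge0// ler_expR ler_pM2r ?invr_gt0 ?expr1n// lerN2 !subr0.
  nra.
pose J (a : R) : R -> R := \1_`[a, (a + 1)%R].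
have mJ a : measurable_fun [set: R] (fun t => (J a t)%:E).
  by apply/measurable_EFinP; exact: measurable_indic.
have J0 a t : 0 <= (J a t)%:E by rewrite lee_fin.
have IJ a : \int[@lebesgue_measure R]_t (J a t)%:E = 1.
  rewrite integral_indic// setIT.
  rewrite [LHS](lebesgue_measure_itv (Interval (BLeft a) (BRight (a + 1)%R))) /=.
  by rewrite lte_fin ltrDl ltr01 -EFinB addrAC subrr add0r.
have c0 : 0 <= (m ^+ 2 * k)%:E by rewrite lee_fin mulr_ge0// sqr_ge0.
have c1 : 0 <= ((1 - m) ^+ 2 * k)%:E by rewrite lee_fin mulr_ge0// sqr_ge0.
have ZJ c a : 0 <= c%:E ->
    \int[@lebesgue_measure R]_t (c%:E * (J a t)%:E) = c%:E.
  by move=> c00; rewrite ge0_integralZl//; [rewrite IJ mule1|exact: mJ].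
have mcJ c a : measurable_fun [set: R] (fun t => c%:E * (J a t)%:E).
  exact: emeasurable_funM.
apply: (@le_trans _ _ (\int[@lebesgue_measure R]_t
    ((m ^+ 2 * k)%:E * (J (-1)%R t)%:E + ((1 - m) ^+ 2 * k)%:E * (J 1%R t)%:E))).
  rewrite ge0_integralD//; last 4 first.
  - by move=> t _; exact: mule_ge0.
  - exact: mcJ.
  - by move=> t _; exact: mule_ge0.
  - exact: mcJ.
  rewrite !ZJ// -EFinD lee_fin.
  have -> : (m ^+ 2 * k + (1 - m) ^+ 2 * k = k / 2 + 2 * (m - 2^-1) ^+ 2 * k)%R by field.
  by rewrite lerDl mulr_ge0// mulr_ge0// sqr_ge0.
apply: ge0_le_integral => //.
- by move=> t _; rewrite adde_ge0// mule_ge0.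
- by apply: emeasurable_funD; exact: mcJ.
- apply/measurable_EFinP; apply: measurable_funM; first exact: mg.
  exact: measurable_normal_pdf.
- move=> t _; rewrite -!EFinM -EFinD lee_fin /J !indicE !mem_setE !in_itv/=.
  have N0 := normal_pdf_ge0 0 1 t.
  have [t1|t1] := boolP (-1 <= t <= -1 + 1)%R.
    have -> : (1 <= t <= 1 + 1)%R = false by apply/negbTE; lra.
    have -> : clip t = 0%R by rewrite /clip; apply/max_idPl; rewrite ge_min; lra.
    rewrite mulr0 addr0 mulr1 sub0r sqrrN ler_wpM2l ?sqr_ge0//; apply: kN; lra.
  rewrite mulr0 add0r; have [t2|t2] := boolP (1 <= t <= 1 + 1)%R.
    have -> : clip t = 1%R.
      by rewrite /clip (min_idPr _)//; [exact/max_idPr|lra].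
    rewrite mulr1 ler_wpM2l ?sqr_ge0//; apply: kN; lra.
  by rewrite mulr0 mulr_ge0// sqr_ge0.
Qed.

End clip_head.

Theorem proposition40 (R : realType) :
  exists2 C : R, 0 < C &
    forall (d : nat) (h : R), (1 <= d)%N -> 0 < h ->
      (mala_gap d h <= (C * h)%:E)%E.
Proof.
pose kappa : R := normal_pdf 0 1 (2 : R) / 2.
have kappa0 : 0 < kappa.
  rewrite divr_gt0// normal_pdfE ?oner_neq0// mulr_gt0 ?expR_gt0//.
  by rewrite normal_peak_gt0// oner_neq0.
exists (18 / kappa); first by rewrite divr_gt0.
case=> // n h _ h0.
have fL := clip_head_Lfun (mala_target R n.+1).
have vk := variance_clip_head_ge R n.
have E18 : (mala_dirichlet h (@clip_head R n) (@clip_head R n) <= (18 * h)%:E)%E.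
  (* 18 = (24 + 6 * 2) / 2, using h^2 <= h in the first regime *)
  have [h1|/ltW h1] := leP h 1.
    apply: (le_trans (mala_dirichlet_clip_head_le (K := 24 * h) (L := 2 * h ^+ 2) n h0 _ _ _)).
    - by rewrite mulr_ge0// ltW.
    - by rewrite mulr_ge0// sqr_ge0.
    - by move=> u; exact: integral_sqr_clip_normal_le.
    by rewrite lee_fin; nra.
  apply: (le_trans (mala_dirichlet_clip_head_le (K := 1) (L := 0) n h0 _ _ _)) => //.
    by move=> u; rewrite mul0r addr0; exact: integral_sqr_clip_normal_le1.
  by rewrite lee_fin; lra.
apply: (@le_trans _ _ (mala_dirichlet h (@clip_head R n) (@clip_head R n) /
    'V_(mala_target R n.+1)[@clip_head R n])%E).
  apply: ereal_inf_lbound; exists (@clip_head R n) => //; split => //.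
  by apply: lt_le_trans vk; rewrite lte_fin.
have := variance_fin_num fL.
move: vk; case: variance => // v; rewrite lee_fin => vk _.
have v0 : 0 < v by exact: lt_le_trans vk.
rewrite inver gt_eqF// lee_pdivrMr// -EFinM (le_trans E18)// lee_fin.
have -> : 18 / kappa * h * v = 18 * h * (v / kappa) by ring.
rewrite ler_peMr//; first by rewrite mulr_ge0// ltW.
by rewrite ler_pdivlMr// mul1r.
Qed.
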